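(* Let $X$ be a (real) Banach space and let $A\subset X$ be a non-empty, closed, convex and bounded set. Let $f:X\to\mathbb{R}\cup\{+\infty\}$ be a lower semicontinuous function and let $a\in\mathrm{dom}\, f$. If for some $r\in\mathbb{R}$ $$r\le \inf f(A),$$ then there exists $\bar x\in[a,A]$ such that $f(\bar x)\le \max\{f(a),r\}$ and $$f^-(\bar x;A-a)\ge r-f(a).$$
   Context: $\mathrm{dom}\, f=\{x\in X: f(x)<+\infty\}$. For a non-empty set $A\subset X$, $\inf f(A):=\inf_{x\in A}f(x)$ and $A-a:=\{x-a: x\in A\}$. The multidirectional interval between a point $a$ and a non-empty set $A$ is $[a,A]:=\{a+t(x-a): t\in[0,1],\ x\in A\}$. For a non-empty set $D\subset X$ and $x\in\mathrm{dom}\, f$, the $D$-directional derivative of $f$ at $x$ is $$f^-(x;D):=\liminf_{t\downarrow 0}\frac{\inf f(x+tD)-f(x)}{t}\in[-\infty,+\infty],$$ where $x+tD=\{x+td: d\in D\}$. *)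

(* Defs.v *)
From HB Require Import structures.
From mathcomp Require Import all_boot all_order all_algebra.
From mathcomp Require Import all_classical all_reals all_analysis.

Set Implicit Arguments.
Unset Strict Implicit.
Unset Printing Implicit Defensive.

Import Order.TTheory GRing.Theory Num.Theory.
Import numFieldNormedType.Exports.

Local Open Scope classical_set_scope.
Local Open Scope ring_scope.

(* [f : X -> \bar R] stands for a function into R \cup {+oo}; theorems assume
   separately that -oo is not a value. *)
Definition domf (R : realType) (X : Type) (f : X -> \bar R) : set X :=
  [set x | (f x < +oo)%E].

(* The multidirectional interval [a, A]. *)
Definition multi_interval (R : realType) (X : lmodType R) (a : X)
    (A : set X) : set X :=
  [set a + t *: (x - a) | t in [set t : R | 0 <= t <= 1] & x in A].

Definition inf_image (R : realType) (X : Type) (f : X -> \bar R)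
    (A : set X) : \bar R :=
  ereal_inf (f @` A).

(* The D-directional derivative f^-(x; D), a liminf as t decreases to 0.  The
   infimum may be infinite, so the quotient is taken in \bar R; the subtraction
   is meaningful for [x] in [domf f]. *)
Definition dir_deriv (R : realType) (X : lmodType R) (f : X -> \bar R) (x : X)
    (D : set X) : \bar R :=
  limf_einf
    (fun t : R => (inf_image f [set (x + t *: d)%R | d in D] - f x) * t^-1%:E)%E
    0^'+.

(* Main.v *)
(* Put s = r - f(a) and D = A - a.  If a itself does not satisfy the conclusion,
   some small step y = a + hd has f(y) < f(a) + s h.  Starting from (y, h), move
   in X x R along (x, t) -> (x + kd, t + k), d in D, as long as f increases at
   rate at most s and t <= 1; convexity makes this relation transitive, and
   boundedness of D, completeness and lower semicontinuity give increasing
   sequences an upper bound.  A maximal (x, t) satisfies f(x) < f(a) + s t and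
   x in a + tD, so t = 1 would give x in A with f(x) < r; hence t < 1, and then
   maximality says precisely that f(x + kd) > f(x) + s k for all small k. *)

Require Import Defs.
From HB Require Import structures.
From mathcomp Require Import all_boot all_order all_algebra.
From mathcomp Require Import all_classical all_reals all_analysis.
From mathcomp Require Import ring lra.

Set Implicit Arguments.
Unset Strict Implicit.
Unset Printing Implicit Defensive.

Import Order.TTheory GRing.Theory Num.Theory.
Import numFieldNormedType.Exports.

Local Open Scope classical_set_scope.
Local Open Scope ring_scope.

(** The Brezis-Browder ordering principle. A greedy sequence gains at each step at least half of the
    height still reachable; a strict gain above its upper bound would stay reachable all along and
    make [phi] grow without bound. *)
Lemma brezis_browder (R : realType) (T : Type) (le : T -> T -> Prop)
    (phi : T -> R) (M : R) (p0 : T) :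
  (forall p, le p p) ->
  (forall q p r, le p q -> le q r -> le p r) ->
  (forall p q, le p q -> phi p <= phi q) ->
  (forall p, phi p <= M) ->
  (forall u : nat -> T, (forall n, le (u n) (u n.+1)) ->
    exists w, forall n, le (u n) w) ->
  exists2 p, le p0 p & forall q, le p q -> phi q = phi p.
Proof.
move=> le_refl le_trans le_phi phi_le chain_ub.
(* Each step covers at least half of the remaining height above p. *)
have half p : exists q, le p q /\ forall v, le p v -> phi v + phi p <= 2 * phi q.
  pose S := phi @` [set v | le p v].
  have supS : has_sup S.
    by split; [exists (phi p), p | exists M => _ [v _ <-]].
  have leS v : le p v -> phi v <= sup S.
    by move=> pv; apply: sup_upper_bound => //; exists v.
  have := leS p (le_refl p); rewrite le_eqVlt => /orP[/eqP eqS|ltS].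
    by exists p; split=> // v /leS; rewrite -eqS; lra.
  have eps_gt0 : 0 < (sup S - phi p) / 2 by lra.
  have [_ [q pq <-] ltq] := sup_adherent eps_gt0 supS.
  by exists q; split=> // v /leS; lra.
have [next nextP] := choice half.
pose u n := iter n next p0.
have u_step n : le (u n) (u n.+1) by rewrite /u iterS; case: (nextP (u n)).
have [w uw] := chain_ub u u_step.
exists w => [|v wv]; first exact: (uw 0).
apply/eqP; rewrite eq_le (le_phi _ _ wv) andbT leNgt; apply/negP => wltv.
(* Every [u n] lies below [v], so twice [phi (u n.+1)] is at least [phi v + phi (u n)]; subtracting
   [phi (u n.+1) <= phi w] leaves a fixed gain per step. *)
have grow n : phi p0 + (phi v - phi w) *+ n <= phi (u n).
  elim: n => [|n IHn]; first by rewrite mulr0n addr0.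
  have uv m : le (u m) v by exact: le_trans (uw m) wv.
  have := (nextP (u n)).2 v (uv n); rewrite -[next (u n)]/(u n.+1).
  by have := le_phi _ _ (uw n.+1); rewrite mulrSr; lra.
have dgt0 : 0 < phi v - phi w by lra.
have := archi_boundP (x := (M - phi p0) / (phi v - phi w)).
have Mp0 : 0 <= (M - phi p0) / (phi v - phi w).
  by apply: divr_ge0; [rewrite subr_ge0|exact: ltW].
move=> /(_ Mp0); set n := Num.bound _; rewrite ltr_pdivrMr// => lt_n.
have := grow n; have := phi_le (u n); rewrite -mulr_natl; lra.
Qed.

(** Merges two successive moves into one: [g] is the convex combination with weights [s / (s + t)]
    and [t / (s + t)]. If [s + t = 0], both coefficients vanish and any point of [D] serves. *)
Lemma convex_set_comb (R : realType) (X : lmodType R) (D : set X)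
    (s t : R) (d e : X) :
  convex_set D -> 0 <= s -> 0 <= t -> D d -> D e ->
  exists2 g, D g & s *: d + t *: e = (s + t) *: g.
Proof.
move=> convD s0 t0 Dd De.
have [st0|stN0] := eqVneq (s + t) 0.
  have [-> ->] : s = 0 /\ t = 0 by split; lra.
  by exists d => //; rewrite addr0 !scale0r addr0.
have st_gt0 : 0 < s + t by rewrite lt_neqAle eq_sym stN0 addr_ge0.
have [k kE] : exists k, k = s / (s + t) by exists (s / (s + t)).
have k0 : 0 <= k by rewrite kE divr_ge0// addr_ge0.
have k1 : k <= 1 by rewrite kE ler_pdivrMr// mul1r lerDl.
have := convD d e (Itv01 k0 k1); rewrite !inE => /(_ Dd De) Dg.
exists (conv (Itv01 k0 k1) (d : convex_lmodType X) e) => //.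
rewrite [conv _ _ _]/(_ + _) /= scalerDr !scalerA /unstable.onem kE.
by congr (_ *: _ + _ *: _); field.
Qed.

(** A pair is a position and a time. The rate bound is written additively, so that it keeps a
    meaning where [f] is infinite. *)
Definition descent (R : realType) (X : lmodType R) (D : set X) (f : X -> \bar R)
    (s : R) (p q : X * R) : Prop :=
  [/\ p.2 <= q.2,
      exists2 d, D d & q.1 = p.1 + (q.2 - p.2) *: d
    & (f q.1 <= f p.1 + (s * (q.2 - p.2))%:E)%E].

Lemma descent_refl (R : realType) (X : lmodType R) (D : set X)
    (f : X -> \bar R) (s : R) (p : X * R) :
  D !=set0 -> descent D f s p p.
Proof.
move=> [d Dd]; split; rewrite ?subrr ?mulr0 ?adde0//.
by exists d; rewrite // scale0r addr0.
Qed.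

Lemma descent_trans (R : realType) (X : lmodType R) (D : set X)
    (f : X -> \bar R) (s : R) (q p r : X * R) :
  convex_set D -> descent D f s p q -> descent D f s q r -> descent D f s p r.
Proof.
move=> convD [pq [d Dd qE] fpq] [qr [e De rE] fqr].
split; first exact: le_trans qr.
  have [g Dg dege] : exists2 g, D g &
      (q.2 - p.2) *: d + (r.2 - q.2) *: e = (q.2 - p.2 + (r.2 - q.2)) *: g.
    by apply: convex_set_comb; rewrite // subr_ge0.
  by exists g; rewrite // rE qE -addrA dege; congr (_ + _ *: _); ring.
apply: (le_trans fqr); apply: (le_trans (leeD2r _ fpq)).
by rewrite -addeA -EFinD (_ : _ + _ = s * (r.2 - p.2)) //; ring.
Qed.

(** Otherwise a level strictly between [b] and [f l] would eventually lie below [f (x n)] and above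
    [c n]. *)
Lemma lsc_le_cvg (R : realType) (X : topologicalType) (f : X -> \bar R)
    (x : X ^nat) (l : X) (c : R ^nat) (b : R) :
  lower_semicontinuous f -> x @ \oo --> l -> c @ \oo --> b ->
  (\forall n \near \oo, (f (x n) <= (c n)%:E)%E) -> (f l <= b%:E)%E.
Proof.
move=> lscf xl cb fc; rewrite leNgt; apply/negP => bf.
have [z bz zf] : exists2 z, b < z & (z%:E < f l)%E.
  case: (f l) bf => [y||//]; last by exists (b + 1); rewrite ?ltry// ltrDl.
  by rewrite lte_fin => bl; exists ((b + y) / 2); rewrite ?lte_fin; lra.
have [V Vl Vf] := lscf _ _ zf.
have cz : \forall n \near \oo, c n < z by exact: (cvgr_lt b).
have /filter_ex[n [[/Vf + fcn] czn]] :
    \forall n \near \oo, (V (x n) /\ (f (x n) <= (c n)%:E)%E) /\ c n < z.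
  by apply: filterI => //; apply: filterI => //; exact: xl.
by apply/negP; rewrite -leNgt (le_trans fcn)// lee_fin ltW.
Qed.

(** Times increase to their supremum, and positions are Lipschitz in time because [D] is bounded, so
    completeness yields a limit pair. Closedness of [D] and lower semicontinuity pass the relation
    to the limit. *)
Lemma descent_seq_ub (R : realType) (X : completeNormedModType R) (D : set X)
    (f : X -> \bar R) (s M : R) (u : nat -> X * R) :
  closed D -> bounded_set D -> (forall x, f x <> -oo%E) ->
  lower_semicontinuous f ->
  (forall m n, (m <= n)%N -> descent D f s (u m) (u n)) ->
  (forall n, (u n).2 <= M) ->
  exists2 w, w.2 <= M & forall n, descent D f s (u n) w.
Proof.
move=> closedD /(@filter_ex _ (pinfty_nbhs R))[K DK] fNoo lscf du uM.
pose t n := (u n).2; pose x n := (u n).1.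
have t_nd : {homo t : m n / (m <= n)%N >-> m <= n} by move=> m n /du[].
have t_ub : has_ubound (range t) by exists M => _ [n _ <-]; exact: uM.
have tT := nondecreasing_cvgn t_nd t_ub; set T := sup _ in tT.
have t_le n : t n <= T by apply: ub_le_sup => //; exists n.
have TM : T <= M by apply: ge_sup => [|_ [n _ <-]]; [exists (t 0%N), 0%N|exact: uM].
have xt m n : (m <= n)%N -> `|x n - x m| <= (t n - t m) * K.
  move=> /du[tmn [d Dd xnE] _]; rewrite /x xnE addrAC subrr add0r normrZ.
  by rewrite ger0_norm ?subr_ge0// ler_wpM2l ?subr_ge0//; exact: DK.
have /cauchy_cvgP/cvg_ex[/= l xl] : cauchy (x @ \oo).
  apply: cauchy_exP => e e0.
  (* The bound [K] may be zero, hence the shifted divisor. *)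
  have K1 : 0 < `|K| + 1 by rewrite ltr_wpDl.
  have /filter_ex[m Tm] : \forall m \near \oo, T - e / (`|K| + 1) < t m.
    by apply: (cvgr_gt T) => //; rewrite ltrBlDr ltrDl divr_gt0.
  exists (x m), m => // n /= mn; rewrite -ball_normE /= distrC.
  apply: le_lt_trans (xt _ _ mn) _.
  have tnm : 0 <= t n - t m by rewrite subr_ge0 t_nd.
  have : t n - t m < e / (`|K| + 1) by have := t_le n; lra.
  rewrite ltr_pdivlMr//; apply: le_lt_trans; rewrite ler_wpM2l//.
  by rewrite (le_trans (ler_norm _))// lerDl.
exists (l, T) => // m; split=> /=; first exact: t_le.
  (* If the supremum is attained at [m], time and position are constant from there on, so [l = x m]
     and any direction in [D] serves. *)
  have [tmT|tmT] := eqVneq (t m) T.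
    have [_ [d Dd _] _] := du m m (leqnn m).
    exists d; rewrite // -/(t m) tmT subrr scale0r addr0.
    apply: (cvg_unique _ xl); first exact: norm_hausdorff.
    apply: cvg_near_cst; exists m => // n /= mn.
    have := xt _ _ mn; rewrite (_ : t n = t m) ?subrr ?mul0r.
      by rewrite normr_le0 subr_eq0 => /eqP.
    by apply/le_anti; rewrite (t_nd _ _ mn) andbT tmT t_le.
  have tmltT : t m < T by rewrite lt_neqAle tmT t_le.
  (* This direction is the limit of the mean velocities from [m] to [n], which lie in the closed set
     [D]. *)
  exists ((T - t m)^-1 *: (l - x m)); last first.
    by rewrite scalerA divff ?subr_eq0 1?eq_sym// scale1r addrC subrK.
  apply: (@closed_cvg _ _ \oo _ (fun n => (t n - t m)^-1 *: (x n - x m))) => //.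
    have tm_lt : \forall n \near \oo, t m < t n by exact: (cvgr_gt T).
    near=> n.
    have [_ [d Dd xnE] _] : descent D f s (u m) (u n).
      by apply: du; near: n; exact: nbhs_infty_ge.
    rewrite /x xnE addrAC subrr add0r scalerA mulVf ?scale1r//.
    by rewrite subr_eq0 gt_eqF//; near: n.
  apply: cvgZ; last by apply: cvgB => //; exact: cvg_cst.
  apply: cvgV; first by rewrite subr_eq0 eq_sym.
  by apply: cvgB => //; exact: cvg_cst.
have := fNoo (x m); rewrite -/(x m) -/(t m).
case fxm : (f (x m)) => [y|//|//] _; last by rewrite addye ?leey.
rewrite -EFinD; apply: (@lsc_le_cvg _ _ _ x _ (fun n => y + s * (t n - t m))) => //.
  apply: cvgD; first exact: cvg_cst.
  by apply: cvgM; [exact: cvg_cst|apply: cvgB => //; exact: cvg_cst].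
by exists m => // n /= /du[_ _]; rewrite -/(x m) fxm -EFinD.
Unshelve. all: by end_near. Qed.

(** The ordering principle is applied to the time coordinate, on pairs whose time is at most [M]. A
    further admissible move of length [h > 0] would raise the time of a maximal pair. *)
Lemma descent_maximal (R : realType) (X : completeNormedModType R) (D : set X)
    (f : X -> \bar R) (s M : R) (p : X * R) :
  D !=set0 -> closed D -> convex_set D -> bounded_set D ->
  (forall x, f x <> -oo%E) -> lower_semicontinuous f -> p.2 <= M ->
  exists q, [/\ descent D f s p q, q.2 <= M &
    forall d h, D d -> 0 < h -> h <= M - q.2 ->
      (f q.1 + (s * h)%:E < f (q.1 + h *: d)%R)%E].
Proof.
move=> D0 closedD convD bndD fNoo lscf pM.
pose S := {q : X * R | q.2 <= M}.
have [|||||q pq qmax] := @brezis_browder R S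
    (fun q r => descent D f s (sval q) (sval r)) (fun q => (sval q).2) M
    (exist _ p pM).
- by move=> q; exact: descent_refl.
- by move=> q r v; exact: descent_trans.
- by move=> q r [].
- by case.
- move=> u du.
  have [||w wM uw] := @descent_seq_ub _ _ D f s M (sval \o u)
      closedD bndD fNoo lscf.
  + apply: homo_leq => // [q|q r v]; first exact: descent_refl.
    exact: descent_trans.
  + by move=> n /=; case: (u n).
  + by exists (exist _ w wM).
exists (sval q); split=> //; first by case: q {pq qmax}.
move=> d h Dd h0 hM; rewrite ltNge; apply/negP => fd.
have rM : (sval q).2 + h <= M by lra.
have : descent D f s (sval q) ((sval q).1 + h *: d, (sval q).2 + h).
  by split; rewrite /= ?lerDl ?(ltW h0)// addrAC subrr add0r //; exists d.
by move=> /(qmax (exist _ (_, _) rM)) /=; lra.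
Qed.

(** The liminf is a supremum of infima over right neighbourhoods of 0, and the interval from 0 to
    [e] is one of them. *)
Lemma dir_deriv_ge (R : realType) (X : lmodType R) (f : X -> \bar R) (x : X)
    (D : set X) (s e : R) :
  f x \is a fin_num -> 0 < e ->
  (forall d h, D d -> 0 < h -> h < e -> (f x + (s * h)%:E <= f (x + h *: d)%R)%E) ->
  (s%:E <= dir_deriv f x D)%E.
Proof.
move=> fx e0 fD; rewrite /dir_deriv limf_einfE.
apply: (@le_trans _ _ (ereal_inf ((fun h : R => ((inf_image f
    [set (x + h *: d)%R | d in D] - f x) * h^-1%:E)%E) @` [set h | 0 < h < e]))).
  apply: le_ereal_inf_tmp => _ [h /andP[h0 he] <-].
  rewrite lee_pdivlMr// -EFinM leeBrDr// addeC.
  by apply: le_ereal_inf_tmp => _ [_ [d Dd <-] <-]; exact: fD.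
apply: ereal_sup_ubound; exists [set h | 0 < h < e] => //.
near=> h; apply/andP; split; near: h; [exact: nbhs_right_gt|exact: nbhs_right_lt].
Unshelve. all: by end_near. Qed.

Lemma dir_deriv_lt (R : realType) (X : lmodType R) (f : X -> \bar R) (x : X)
    (D : set X) (s e : R) :
  f x \is a fin_num -> 0 < e -> (dir_deriv f x D < s%:E)%E ->
  exists h d, [/\ D d, 0 < h, h < e & (f (x + h *: d)%R < f x + (s * h)%:E)%E].
Proof.
move=> fx e0 ltds; apply: contrapT => noh.
move: ltds; rewrite ltNge => /negP; apply; apply: dir_deriv_ge fx e0 _.
move=> d h Dd h0 he; rewrite leNgt; apply/negP => fd.
by apply: noh; exists h, d.
Qed.

Theorem theorem1p1 (R : realType) (X : completeNormedModType R)
  (A : set X) (f : X -> \bar R) (a : X) (r : R) :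
  A !=set0 -> closed A -> convex_set A -> bounded_set A ->
  (forall x, f x <> -oo%E) ->
  lower_semicontinuous f ->
  domf f a ->
  (r%:E <= inf_image f A)%E ->
  exists xbar : X,
    [/\ multi_interval a A xbar,
        (f xbar <= Order.max (f a) r%:E)%E &
        (r%:E - f a <= dir_deriv f xbar [set (x - a)%R | x in A])%E].
Proof.
move=> A0 closedA convA bndA fNoo lscf doma rA.
set D := [set x - a | x in A].
have DE d : D d <-> A (a + d).
  split=> [[x Ax <-]|Ad]; first by rewrite addrC subrK.
  by exists (a + d); rewrite // addrAC subrr add0r.
have D0 : D !=set0 by case: A0 => x Ax; exists (x - a), x.
have closedD : closed D.
  rewrite (_ : D = (fun d => a + d) @^-1` A); last by apply/seteqP; split=> d /DE.
  by apply: preimage_closed => // d _; apply: cvgD; [exact: cvg_cst|exact: cvg_id].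
have convD : convex_set D.
  move=> x y k; rewrite !inE => /DE Ax /DE Ay; apply/DE.
  have := convA (a + x) (a + y) k; rewrite !inE => /(_ Ax Ay).
  congr A; rewrite -[LHS]/(k%:num *: (a + x) + unstable.onem k%:num *: (a + y)).
  rewrite -[conv k x y]/(k%:num *: x + unstable.onem k%:num *: y).
  by rewrite !scalerDr addrACA -scalerDl unstable.add_onemK scale1r.
have bndD : bounded_set D.
  have /(@filter_ex _ (pinfty_nbhs R))[K AK] := bndA.
  rewrite /= /bounded_near; near=> N => _ [x Ax <-] /=; apply: (@le_trans _ _ (K + `|a|)).
    by rewrite (le_trans (ler_normB _ _))// lerD2r; exact: AK.
  by near: N; apply: nbhs_pinfty_ge; exact: num_real.
have [c fa] : exists c, f a = c%:E.
  by move: doma (fNoo a); rewrite /domf /=; case: (f a) => // c; exists c.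
have fafin : f a \is a fin_num by rewrite fa.
rewrite fa -EFinB.
have [ge_s|lt_s] := leP (r - c)%:E (dir_deriv f a D).
  exists a; split; [|by rewrite fa le_max lexx|exact: ge_s].
  have [x Ax] := A0; exists 0; first by rewrite /= lexx ler01.
  by exists x; rewrite // scale0r addr0.
(* The strict inequality gained by this first step persists along all later moves; it is what will
   exclude time 1. *)
have [h [d [Dd h0 h1 fah]]] := dir_deriv_lt fafin ltr01 lt_s.
have [[x t] [[/= ht [e De xE] fx] t1 xmax]] :=
  @descent_maximal R X D f (r - c) 1 (a + h *: d, h) D0 closedD convD bndD
    fNoo lscf (ltW h1).
have {}fx : (f x < (c + (r - c) * t)%:E)%E.
  apply: le_lt_trans fx _.
  apply: (@lt_le_trans _ _ (f a + ((r - c) * h)%:E + ((r - c) * (t - h))%:E)%E).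
    by rewrite lteD2rE.
  by rewrite fa -!EFinD lee_fin; lra.
have [g Dg xag] : exists2 g, D g & x = a + t *: g.
  have th : 0 <= t - h by rewrite subr_ge0.
  have [g Dg E] := convex_set_comb convD (ltW h0) th Dd De.
  by exists g; rewrite // xE -addrA E [h + _]addrC subrK.
(* At time 1 the point [x = a + g] lies in [A], while the strict bound reads
   [f x < c + (r - c) = r]. *)
have t_lt1 : t < 1.
  rewrite lt_neqAle t1 andbT; apply/eqP => tE.
  have Ax : A x by rewrite xag tE scale1r; apply/DE.
  have : (r%:E <= f x)%E.
    by apply: (le_trans rA); apply: ereal_inf_lbound; exists x.
  by apply/negP; rewrite -ltNge (lt_le_trans fx)// lee_fin tE; lra.
have fxfin : f x \is a fin_num.
  by move: fx (fNoo x); case: (f x).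
exists x; split.
- have [y Ay yE] := Dg; exists t; first by rewrite /= t1 andbT; lra.
  by exists y; rewrite // yE xag.
(* For [t] between 0 and 1, [c + (r - c) * t] is a convex combination of [c] and [r]. *)
- rewrite -EFin_max; apply: (le_trans (ltW fx)); rewrite lee_fin.
  by rewrite le_max; apply/orP; have [rc|rc] := leP r c; [left|right]; nra.
(* Moves shorter than [1 - t] stay under the time cap, so maximality applies to them. *)
- have t1' : 0 < 1 - t by rewrite subr_gt0.
  apply: (dir_deriv_ge fxfin t1') => k v Dk v0 vt.
  by apply/ltW/xmax => //; exact: ltW.
Unshelve. all: by end_near. Qed.
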